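(* Let $\mathcal{G}=(\mathcal{A},\lim(L(\mathfrak{A})))$ be a regular weighted limit game (with finite arena $\mathcal{A}$ with vertex set $V$, and $\epsilon\notin L(\mathfrak{A})$) and let $\sigma$ be an optimal strategy for Player $0$ in $\mathcal{G}$. Then $W_0(\mathcal{G})=\{v\in V\mid\mathrm{val}_{\mathcal{G}}(\sigma,v)<\infty\}$ and $W_1(\mathcal{G})=\{v\in V\mid\mathrm{val}_{\mathcal{G}}(\sigma,v)=\infty\}$.
   Context: $\mathbb{N}$ denotes the nonnegative integers, $\overline{\mathbb{N}}=\mathbb{N}\cup\{\infty\}$ with $n<\infty$ and $n+\infty=\infty$; $\min\emptyset=\infty$. Fix a finite nonempty set $C$ of colors. A DFA $\mathfrak{A}=(Q,C,q_I,\delta,F)$ has finite state set $Q$, initial state $q_I$, transition function $\delta\colon Q\times C\to Q$ and accepting states $F\subseteq Q$; $L(\mathfrak{A})\subseteq C^*$ is its language. An arena $\mathcal{A}=(V,V_0,V_1,E,w,c)$ consists of a finite directed graph $(V,E)$ in which every vertex has an outgoing edge, a partition of $V$ into vertices $V_0$ of Player $0$ and $V_1$ of Player $1$, a weight function $w\colon E\to\mathbb{N}$ and a coloring $c\colon V\to C$. A play is an infinite path $\rho=v_0v_1v_2\cdots$. The weight of a finite path is the sum of the weights of its edges; $c$ is applied vertex-wise to paths. For $K\subseteq C^*$ with $\epsilon\notin K$, $\lim(K)$ is the set of $\alpha_0\alpha_1\cdots\in C^\omega$ with $\alpha_0\cdots\alpha_j\in K$ for infinitely many $j$. A weighted limit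 game is $\mathcal{G}=(\mathcal{A},\lim(K))$; it is regular if $K=L(\mathfrak{A})$ for a DFA $\mathfrak{A}$ over $C$. A play $\rho$ is winning for Player $0$ if $c(\rho)\in\lim(K)$ and winning for Player $1$ otherwise. The value of a play (depending on $K$) is $$\mathrm{val}_{\mathcal{G}}(v_0v_1v_2\cdots)=\sup_{j\in\mathbb{N}}\ \min_{j'>j,\ c(v_0\cdots v_{j'})\in K} w(v_j\cdots v_{j'})\in\overline{\mathbb{N}}.$$ A strategy for Player $i$ is a map $\sigma\colon V^*V_i\to V$ with $(v_j,\sigma(v_0\cdots v_j))\in E$; a play is consistent with $\sigma$ if $v_{j+1}=\sigma(v_0\cdots v_j)$ whenever $v_j\in V_i$. A strategy for Player $i$ is winning from $v$ if every play starting in $v$ and consistent with it is winning for Player $i$. The winning region $W_i(\mathcal{G})$ is the set of vertices from which Player $i$ has a winning strategy. For a strategy $\sigma$ of Player $0$, $\mathrm{val}_{\mathcal{G}}(\sigma,v)=\sup_\rho\mathrm{val}_{\mathcal{G}}(\rho)$ over all plays $\rho$ starting in $v$ and consistent with $\sigma$. A strategy $\sigma$ for Player $0$ is optimal if $\mathrm{val}_{\mathcal{G}}(\sigma,v)\le\mathrm{val}_{\mathcal{G}}(\sigma',v)$ for every strategy $\sigma'$ for Player $0$ and every vertex $v$. *)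

(* Defs.v *)
From HB Require Import structures.
From mathcomp Require Import all_boot all_order.
From mathcomp Require Import boolp classical_sets.

Set Implicit Arguments.
Unset Strict Implicit.
Unset Printing Implicit Defensive.

Import Order.TTheory.

Local Open Scope classical_set_scope.
Local Open Scope nat_scope.

(** The extended naturals, as a totally ordered set: [None] is infinity. *)
Definition enat : Type := option nat.
Definition Fin (n : nat) : enat := Some n.
Definition Infty : enat := None.

HB.instance Definition _ := Choice.copy enat (option nat).

Definition enat_le (x y : enat) : bool :=
  match x, y with
  | _, None => true
  | None, Some _ => false
  | Some m, Some n => m <= n
  end.

Lemma enat_le_refl : reflexive enat_le.
Proof. by case=> [n|] /=. Qed.

Lemma enat_le_anti : antisymmetric enat_le.
Proof. by case=> [m|] [n|] //= /anti_leq ->. Qed.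

Lemma enat_le_trans : transitive enat_le.
Proof. by case=> [m|] [n|] [p|] //=; apply: leq_trans. Qed.

Lemma enat_le_total : total enat_le.
Proof. by case=> [m|] [n|] //=; apply: leq_total. Qed.

Fact enat_display : Order.disp_t. Proof. exact: Order.Disp tt tt. Qed.

HB.instance Definition _ := Order.Le_isPOrder.Build enat_display enat
  enat_le_refl enat_le_anti enat_le_trans.
HB.instance Definition _ :=
  Order.POrder_isTotal.Build enat_display enat enat_le_total.

(** With these default values, sup of the empty set is 0 and
    min of the empty set is infinity. *)
Definition enat_sup (S : set enat) : enat := supremum (Fin 0) S.
Definition enat_min (S : set enat) : enat := infimum Infty S.

Lemma enat_min_mem (S : set enat) x :
  S x -> S (enat_min S) /\ (enat_min S <= x)%O.
Proof.
move=> Sx; rewrite /enat_min /infimum.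
have /negbTE -> : S != set0 by apply/set0P; exists x.
have [m [Sm mlb]] : exists m, S m /\ lbound S m.
  case: (pselect (exists n, `[< S (Fin n) >])) => [exS|nS].
    exists (Fin (ex_minn exS)); case: ex_minnP => m /asboolP Sm mmin.
    by split=> // -[n|] // Sn; apply: mmin; apply/asboolP.
  exists x; split=> // -[n|] Sn; last by case: x {Sx}.
  by case: nS; exists n; apply/asboolP.
case: xgetP => [y _ [ylb yglb]|nex]; last first.
  by case: (nex m); split=> // z zlb; apply: zlb.
split; last exact: ylb.
suff -> : y = m by [].
by apply/eqP; rewrite eq_le (ylb _ Sm) (yglb _ mlb).
Qed.

Lemma enat_sup_leP (S : set enat) y :
  (enat_sup S <= y)%O <-> (forall x, S x -> (x <= y)%O).
Proof.
rewrite /enat_sup /supremum.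
case: ifPn => [/eqP -> |/set0P[x0 Sx0]]; first by split=> // _; case: y.
have uI : ubound S Infty by case.
have [Sm mlb] := enat_min_mem uI.
have mlb' z : ubound S z -> (enat_min (ubound S) <= z)%O.
  by move=> uz; case: (enat_min_mem uz).
case: xgetP => [s _ [sub slub]|nex]; last first.
  by case: (nex (enat_min (ubound S))); split.
split=> [sy x Sx|yub]; last exact: slub.
exact: le_trans (sub _ Sx) sy.
Qed.

Record dfa (C : finType) := DFA {
  dfa_state : finType;
  dfa_init : dfa_state;
  dfa_trans : dfa_state -> C -> dfa_state;
  dfa_accept : {set dfa_state}
}.

Definition dfa_lang (C : finType) (M : dfa C) : set (seq C) :=
  [set s | foldl (@dfa_trans C M) (dfa_init M) s \in dfa_accept M].

Inductive player := Player0 | Player1.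

(** The vertices of Player 1 are the complement of [arena_V0]; the values of
    [arena_weight] outside the edge relation are never used on a play. *)
Record arena (C : finType) := Arena {
  vertex :> finType;
  arena_V0 : {set vertex};
  arena_edge : rel vertex;
  arena_total : forall v, exists u, arena_edge v u;
  arena_weight : vertex -> vertex -> nat;
  arena_color : vertex -> C
}.

Definition owned (C : finType) (A : arena C) (i : player) : {set A} :=
  match i with
  | Player0 => arena_V0 A
  | Player1 => (~: arena_V0 A)%SET
  end.

(** The game is determined by its language [K], and not just by [lim K]: the
    value of a play depends on [K]. *)
Record limit_game (C : finType) := LimitGame {
  game_arena :> arena C;
  game_lang : set (seq C);
  game_lang_eps : ~ game_lang [::]
}.

Definition regular (C : finType) (G : limit_game C) : Prop :=
  exists M : dfa C, game_lang G = dfa_lang M.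

Definition lim (C : finType) (K : set (seq C)) : set (nat -> C) :=
  [set alpha | forall n, exists2 j, n <= j & K (mkseq alpha j.+1)].

Section Games.
Variables (C : finType) (G : limit_game C).
Implicit Types (i : player) (rho : nat -> G) (v : G).

Definition is_play rho : Prop := forall j, arena_edge (rho j) (rho j.+1).

Definition wins i rho : Prop :=
  match i with
  | Player0 => lim (game_lang G) (@arena_color C G \o rho)
  | Player1 => ~ lim (game_lang G) (@arena_color C G \o rho)
  end.

Definition infix_weight rho (j j' : nat) : nat :=
  \sum_(j <= k < j') arena_weight (rho k) (rho k.+1).

Definition val_play rho : enat :=
  enat_sup [set enat_min [set Fin (infix_weight rho j j') | j' in
      [set j' | j < j' /\
                game_lang G (mkseq (@arena_color C G \o rho) j'.+1)]]
    | j in [set: nat]].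

(** A nonempty history [h ++ [:: v]] is passed as the two arguments [h] and
    [v].  The history is an arbitrary word, not necessarily a path; moves at
    vertices not owned by the player are unconstrained and never used. *)
Record strategy i := Strategy {
  move :> seq G -> G -> G;
  move_edge : forall h v, v \in owned G i -> arena_edge v (move h v)
}.

Definition consistent i (sigma : strategy i) rho : Prop :=
  forall j, rho j \in owned G i -> rho j.+1 = sigma (mkseq rho j) (rho j).

Definition outcomes i (sigma : strategy i) v : set (nat -> G) :=
  [set rho | [/\ is_play rho, rho 0 = v & consistent sigma rho]].

Definition winning_from i (sigma : strategy i) v : Prop :=
  forall rho, outcomes sigma v rho -> wins i rho.

Definition win_region i : set G :=
  [set v | exists sigma : strategy i, winning_from sigma v].

Definition val_strategy (sigma : strategy Player0) v : enat :=
  enat_sup [set val_play rho | rho in outcomes sigma v].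

Definition optimal (sigma : strategy Player0) : Prop :=
  forall (sigma' : strategy Player0) v,
    (val_strategy sigma v <= val_strategy sigma' v)%O.

End Games.

Arguments win_region {C} G i.
Arguments strategy {C} G i.

(* Main.v *)
(** Reading the automaton along a play turns the game into a Büchi game on the
    finite graph of pairs (vertex, state reached after reading that vertex).
    The region [Z] of Player 0 is the greatest fixpoint of the map sending [Z]
    to the set from which she can force a visit, after at least one step, to an
    accepting position of [Z].  On [Z] the attractor rank bounds the number of
    steps to the next such visit by a constant, so she has a strategy of finite
    value; off [Z] the stage at which a position left the greatest fixpoint
    iteration never increases under suitable moves of Player 1 and decreases at
    each accepting position, so he can enforce only finitely many of them.
    Optimality transfers the finite value to [sigma]. *)
Require Import Defs.
From mathcomp Require Import all_boot all_order.

Set Implicit Arguments.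
Unset Strict Implicit.
Unset Printing Implicit Defensive.

(** * Büchi games on a finite graph, with ranks for both players *)

Section Buchi.
Variables (P : finType) (e : rel P) (F : {set P}).
Implicit Types (own Y Z : {set P}) (p q : P).

(** The controllable predecessor operator of the player who owns [own]. *)
Definition cpre own (Y : {pred P}) : {set P} :=
  [set p | if p \in own then [exists q, e p q && (q \in Y)]
           else [forall q, e p q ==> (q \in Y)]].

Lemma cpreS own (Y Y' : {pred P}) :
  {subset Y <= Y'} -> cpre own Y \subset cpre own Y'.
Proof.
move=> sY; apply/subsetP=> p; rewrite !inE; case: ifP => _.
  by case/existsP=> q /andP[epq /sY Yq]; apply/existsP; exists q; rewrite epq.
by move/forallP=> H; apply/forallP=> q; apply/implyP=> /(implyP (H q)) /sY.
Qed.

Lemma setC_cpre own Y : ~: cpre own (mem Y) = cpre (~: own) (mem (~: Y)).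
Proof.
apply/setP=> p; rewrite !inE; case: (p \in own) => /=.
  rewrite negb_exists; apply: eq_forallb => q.
  by rewrite negb_and inE implybE.
rewrite negb_forall; apply: eq_existsb => q.
by rewrite negb_imply inE.
Qed.

(** The target [F :&: Z] stands under [cpre], so being in it already does not count: the visit must
    come after a move, which makes it repeatable. *)
Definition attr_step own Z Y : {set P} := cpre own (mem (F :&: Z :|: Y)).
Definition attr own Z : {set P} := fixset (attr_step own Z).

Lemma attr_step_mono own Z : {homo attr_step own Z : Y Y' / Y \subset Y'}.
Proof.
by move=> Y Y' sY; apply: cpreS => q; apply: (subsetP (setUS _ sY)).
Qed.

Lemma attr_mono own : {homo attr own : Z Z' / Z \subset Z'}.
Proof.
move=> Z Z' sZ; rewrite /attr /fixset.
elim: #|P| => [|n IHn] /=; first exact: sub0set.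
by apply: cpreS => q; apply: (subsetP (setUSS (setIS _ sZ) IHn)).
Qed.

Theorem buchi_ranks own : exists (Z : {set P}) (r l : P -> nat),
  (forall p, p \in Z -> p \in cpre own
     [pred q | (q \in Z) && ((q \in F) || (r q < r p))]) /\
  (forall p, p \notin Z -> p \in cpre (~: own)
     [pred q | (q \notin Z) && (l q + (q \in F) <= l p)]).
Proof.
have aM := @attr_mono own.
pose Z := cofixset (attr own); exists Z.
(* [fix_order] is the stage of entry into a least fixpoint, and 0 outside it; positivity thus
   encodes membership. The complement of [Z] is the least fixpoint of [funsetC (attr own)]. *)
exists (fix_order (attr_step own Z)), (fix_order (funsetC (attr own))).
split=> p pZ.
  have sM := @attr_step_mono own Z.
  have defZ : fixset (attr_step own Z) = Z by rewrite -[RHS](cofixsetK aM).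
  have rp : 0 < fix_order (attr_step own Z) p by rewrite fix_order_gt0 defZ.
  have pfix : p \in fixset (attr_step own Z) by rewrite defZ.
  have := in_iter sM pfix (leqnn _); rewrite -(prednK rp) /=.
  apply: (subsetP (cpreS _ _)) => q qY.
  rewrite inE; move/setUP: qY; case => [/setIP[-> ->] //|].
  rewrite (in_iter_fixE sM) fix_order_gt0 defZ => /andP[-> qr] /=.
  by rewrite (leq_ltn_trans qr) ?orbT // prednK.
have lM := funsetC_mono aM.
rewrite inE negbK in pZ.
have lp : 0 < fix_order (funsetC (attr own)) p by rewrite fix_order_gt0.
have := in_iter lM pZ (leqnn _); rewrite -(prednK lp) /=.
(* [L] is the stage just before [p] leaves [Z]. Unfolding [attr] once before complementing shows
   that [q] has left by the stage of [p], and already by stage [L] if [q] is in [F]. *)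
set L := iter _ _ _; rewrite /funsetC /attr -fixsetK;
  last exact: attr_step_mono.
rewrite setC_cpre; apply: (subsetP (cpreS _ _)) => q /=.
rewrite !inE !negb_or !negb_and !negbK => /andP[qF qL].
have {}qL : q \in iter (fix_order (funsetC (attr own)) p)
                         (funsetC (attr own)) set0.
  by rewrite -(prednK lp) /= -/L inE.
have := qL; rewrite (in_iter_fixE lM) fix_order_gt0 => /andP[-> ql] /=.
rewrite prednK //; case: (boolP (q \in F)) qF => [_ /= qL'|_ _];
  last by rewrite addn0.
by rewrite addn1 -(prednK lp) ltnS; apply: fix_order_small.
Qed.
End Buchi.

From mathcomp Require Import boolp classical_sets.

Import Order.TTheory.

(** * The product of the arena with the automaton *)

Section Product.
Variables (C : finType) (G : limit_game C) (M : dfa C).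
Hypothesis defL : game_lang G = dfa_lang M.
Implicit Types (i : player) (v : G) (rho : nat -> G).

Definition position := (vertex G * dfa_state M)%type.
Implicit Types (p q : position) (Z : {set position}).

Definition run (s : seq G) : dfa_state M :=
  foldl (@dfa_trans C M) (dfa_init M) (map (@arena_color C G) s).

Lemma run_rcons s v :
  run (rcons s v) = dfa_trans (run s) (arena_color v).
Proof. by rewrite /run map_rcons foldl_rcons. Qed.

Definition pos rho j : position := (rho j, run (mkseq rho j.+1)).

Definition pedge p q :=
  arena_edge p.1 q.1 && (q.2 == dfa_trans p.2 (arena_color q.1)).

Definition powned i : {set position} := [set p | p.1 \in owned G i].

Definition paccept : {set position} := [set p | p.2 \in dfa_accept M].

Lemma powned1 : powned Player1 = (~: powned Player0)%SET.
Proof. by apply/setP=> p; rewrite !inE. Qed.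

Lemma pedge_play rho j : is_play rho -> pedge (pos rho j) (pos rho j.+1).
Proof. by move=> play; rewrite /pedge /= play mkseqS run_rcons eqxx. Qed.

Lemma paccept_play rho j :
  pos rho j \in paccept <->
  game_lang G (mkseq (@arena_color C G \o rho) j.+1).
Proof. by rewrite defL inE /dfa_lang /= /run -map_comp. Qed.

(** A positional choice in the product is a strategy in [G], since the history determines the state
    of [M]. Keeping [i] and [R] general serves both halves of [buchi_ranks]. *)
Lemma forcing_strategy i Z (R : rel position) :
    (forall p, p \in Z ->
       p \in cpre pedge (powned i) [pred q | (q \in Z) && R p q]) ->
  exists sigma : strategy G i, forall v rho,
    (v, run [:: v]) \in Z -> outcomes sigma v rho ->
    forall j, R (pos rho j) (pos rho j.+1).
Proof.
move=> force.
pose good h v u := let p := (v, run (rcons h v)) in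
  let q := (u, dfa_trans p.2 (arena_color u)) in
  [&& arena_edge v u, q \in Z & R p q].
(* The fallback successor only makes [move] total: at owned positions of [Z], [force] yields a
   [good] vertex. *)
pose move h v := if [pick u | good h v u] is Some u then u
                 else xchoose (arena_total v).
have move_edge h v : v \in owned G i -> arena_edge v (move h v).
  move=> _; rewrite /move; case: pickP => [u /and3P[] //|_].
  exact: xchooseP (arena_total v).
exists (Strategy move_edge) => v rho vZ [play rho0 cons].
suff step j : pos rho j \in Z ->
    (pos rho j.+1 \in Z) && R (pos rho j) (pos rho j.+1).
  have inZ j : pos rho j \in Z.
    by elim: j => [|j /step /andP[] //]; rewrite /pos /mkseq /= rho0.
  by move=> j; case/andP: (step j (inZ j)).
move=> jZ; have := force _ jZ; rewrite !inE.
have pE := pedge_play j play; case: ifPn => [own|_]; last first.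
  by move/forallP/(_ (pos rho j.+1)); rewrite pE.
case/existsP=> -[u s] /andP[/andP[/= uE /eqP /= -> uR]].
have : good (mkseq rho j) (rho j) (rho j.+1).
  rewrite (cons j own) /= /move; case: pickP => // /(_ u).
  by rewrite /good -mkseqS /= uE; move: uR; rewrite inE => ->.
by rewrite /good -mkseqS => /and3P[_];
   rewrite /pos (mkseqS _ j.+1) run_rcons => -> ->.
Qed.

Lemma play_of_strategies (s0 : strategy G Player0) (s1 : strategy G Player1) v :
  exists rho, outcomes s0 v rho /\ outcomes s1 v rho.
Proof.
pose mv h v := if v \in arena_V0 G then s0 h v else s1 h v.
pose st n := iter n (fun hv => (rcons hv.1 hv.2, mv hv.1 hv.2)) ([::], v).
pose rho n := (st n).2.
have hist n : (st n).1 = mkseq rho n.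
  by elim: n => // n IHn; rewrite mkseqS -IHn.
have rhoS n : rho n.+1 = mv (mkseq rho n) (rho n) by rewrite -hist.
have play : is_play rho.
  move=> n; rewrite rhoS /mv; case: ifPn => own.
    exact: (move_edge s0).
  by apply: (move_edge s1); rewrite inE.
exists rho; split; split=> // n; rewrite rhoS /mv /owned.
  by move=> ->.
by rewrite inE => /negbTE ->.
Qed.

(** An infinite minimum over the empty set would make the supremum infinite, so some accepted prefix
    ends beyond every [j]. *)
Lemma val_finite_wins rho : (val_play rho < Infty)%O -> wins Player0 rho.
Proof.
case E: (val_play rho) => [n|] // _ j.
have /enat_sup_leP/(_ _ (ex_intro2 _ _ j I erefl)) : (val_play rho <= Fin n)%O.
  by rewrite E.
set S := (X in enat_min X).
case: (pselect (S !=set0)%classic) => [[_ [j' [ltj Kj'] _]] _|/nonemptyPn ->].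
  by exists j' => //; apply: ltnW.
by rewrite /enat_min /infimum eqxx.
Qed.

Definition max_weight := \max_(e : G * G) arena_weight e.1 e.2.

Lemma infix_weight_le rho j j' :
  infix_weight rho j j' <= (j' - j) * max_weight.
Proof.
rewrite -sum_nat_const_nat; apply: leq_sum => k _.
exact: (leq_bigmax (F := fun e : G * G => _) (rho k, rho k.+1)).
Qed.

Lemma val_play_le rho B :
    (forall j, exists2 j', j < j' <= j + B & pos rho j' \in paccept) ->
  (val_play rho <= Fin (B * max_weight))%O.
Proof.
move=> acc; apply/enat_sup_leP => _ [j _ <-].
have [j' /andP[ltj lej] /paccept_play Kj'] := acc j.
set S := (X in enat_min X).
have /enat_min_mem[_ min_le] : S (Fin (infix_weight rho j j')) by exists j'.
apply: le_trans min_le _.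
apply: leq_trans (infix_weight_le _ _ _) _.
by rewrite leq_mul2r leq_subLR lej orbT.
Qed.

Theorem finite_value_or_win1 v :
  (exists sigma : strategy G Player0, (val_strategy sigma v < Infty)%O) \/
  win_region G Player1 v.
Proof.
have [Z [r [l [force0 force1]]]] :=
  buchi_ranks pedge paccept (powned Player0).
have [vZ|vZ] := boolP ((v, run [:: v]) \in Z); [left|right].
  have [sigma step] := forcing_strategy
    (R := fun p q => (q \in paccept) || (r q < r p)) force0.
  (* Without an accepting visit the rank drops at each move, at most [\max_p r p] times; one further
     move must then accept. *)
  exists sigma; pose B := (\max_p r p).+1.
  apply: (@le_lt_trans _ _ (Fin (B * max_weight))) => //.
  apply/enat_sup_leP => _ [rho out <-]; apply: val_play_le => j.
  have {vZ out} := step v rho vZ out.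
  suff main n k : r (pos rho k) <= n ->
      (forall j, (pos rho j.+1 \in paccept) ||
                 (r (pos rho j.+1) < r (pos rho j))) ->
      exists2 j', k < j' <= k + n.+1 & pos rho j' \in paccept.
    by move=> H; apply: main => //; apply: leq_bigmax.
  elim: n k => [|n IHn] k rk H; case/orP: (H k) => [acc|lt_r].
  - by exists k.+1; rewrite // addn1 leqnn.
  - by have := leq_trans lt_r rk.
  - by exists k.+1; rewrite // ltnSn -addSnnS leq_addr.
  have [j' /andP[ltj lej] acc] := IHn k.+1 (leq_trans lt_r rk) H.
  by exists j' => //; rewrite (ltnW ltj) addnS -addSn.
have force1' p : p \in (~: Z)%SET -> p \in cpre pedge (powned Player1)
    [pred q | (q \in (~: Z)%SET) && (l q + (q \in paccept) <= l p)].
  rewrite inE powned1 => /force1.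
  by apply: (fintype.subsetP (cpreS _ _ _)) => q; rewrite !inE.
have [sigma step] := forcing_strategy
  (R := fun p q => l q + (q \in paccept) <= l p) force1'.
exists sigma => rho out inf.
have {out vZ}step : forall j, l (pos rho j.+1) + (pos rho j.+1 \in paccept)
    <= l (pos rho j) by apply: step out; rewrite inE.
have mono j k : l (pos rho (j + k)) <= l (pos rho j).
  elim: k => [|k IHk]; first by rewrite addn0.
  by rewrite addnS (leq_trans _ IHk) // (leq_trans _ (step _)) ?leq_addr.
suff main n j : l (pos rho j) <= n -> False
  by exact: main (leqnn (l (pos rho 0))).
elim: n j => [|n IHn] j lj.
  (* Asking for an index from [j.+1] on gives the accepting position a predecessor [j' >= j], where
     [l] is still within the bound; the move from there lowers [l] strictly. *)
  all: have [[|j'] // lejj /paccept_play acc] := inf j.+1.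
  all: have := step j'; rewrite acc addn1 => lt_l.
  all: have := leq_trans lt_l (leq_trans _ lj).
  all: rewrite -(subnKC (lejj : j <= j')) mono => /(_ isT) //.
exact: IHn.
Qed.

End Product.

Theorem lemma9 (C : finType) (hC : 0 < #|C|) (G : limit_game C)
    (hG : regular G) (sigma : strategy G Player0) (hsigma : optimal sigma) :
  win_region G Player0 = [set v | (val_strategy sigma v < Infty)%O]%classic /\
  win_region G Player1 = [set v | val_strategy sigma v = Infty]%classic.
Proof.
have [M defL] := hG.
have ltI x : (x < Infty)%O <-> x <> Infty by case: x.
have win0 v : (val_strategy sigma v < Infty)%O -> win_region G Player0 v.
  move=> fin; exists sigma => rho out; apply: val_finite_wins.
  apply: le_lt_trans fin.
  have /enat_sup_leP := lexx (val_strategy sigma v); apply.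
  by exists rho.
have fin_or_win1 v :
    (val_strategy sigma v < Infty)%O \/ win_region G Player1 v.
  have [[s fin]|] := finite_value_or_win1 defL v; [left|by right].
  exact: le_lt_trans (hsigma s v) fin.
have disj v : win_region G Player0 v -> win_region G Player1 v -> False.
  move=> [s0 w0] [s1 w1]; have [rho [o0 o1]] := play_of_strategies s0 s1 v.
  exact: w1 rho o1 (w0 rho o0).
(* Disjointness of the winning regions turns the two implications into equalities. *)
split; apply/seteqP; split=> v /=.
- by move=> w0; have [//|/(disj v w0)] := fin_or_win1 v.
- exact: win0.
- move=> w1; apply: contrapT => /ltI /win0 w0; exact: disj w0 w1.
- by move=> inf; have [/ltI|] := fin_or_win1 v.
Qed.
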